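(* Let $G$ be a transitive permutation group on a finite set $\Omega$ of cardinality $n$. Then $\alpha(R(G))\le n$, with equality if and only if $r(G)=n-1$.
   Context: Permutations act on the right. On the group $\mathrm{Sym}(\Omega)$ of all permutations of $\Omega$ use the Hamming distance $d(\pi,\sigma)=|\{x\in\Omega : x\pi\neq x\sigma\}|$. The remoteness of $G\le \mathrm{Sym}(\Omega)$ is $r(G)=\min_{v\in \mathrm{Sym}(\Omega)}\max_{g\in G} d(v,g)$. The remoteness graph $R(G)$ has vertex set $\Omega^2$, and two distinct ordered pairs $(a,b),(c,d)\in\Omega^2$ are adjacent in $R(G)$ if and only if $a=c$, or $b=d$, or there exists $g\in G$ such that $(b,d)=(ag,cg)$. For a graph $X$, $\alpha(X)$ denotes its stability (independence) number, i.e. the maximum size of a set of pairwise non-adjacent vertices. *)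

(* Defs.v *)
From mathcomp Require Import all_boot all_fingroup.

Set Implicit Arguments.
Unset Strict Implicit.
Unset Printing Implicit Defensive.

Import GroupScope.

(* A graph on the finite type V is given by its adjacency relation e. *)
Section Stability.

Variables (V : finType) (e : rel V).

Definition stable_set (S : {set V}) : bool :=
  [forall x in S, forall y in S, (x != y) ==> ~~ e x y].

Definition stability_number : nat := \max_(S : {set V} | stable_set S) #|S|.

End Stability.

(* Permutations act on the right: the product s * t of {perm T} applies s
   first, and the image written x s on paper is s x here. *)
Section Remoteness.

Variable T : finType.

Definition hamming_dist (s t : {perm T}) : nat := #|[set x | s x != t x]|.

Variable G : {set {perm T}}.

Definition max_dist (v : {perm T}) : nat := \max_(g in G) hamming_dist v g.

(* The base point 1 only witnesses that {perm T} is inhabited. *)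
Definition remoteness : nat := max_dist [arg min_(v < 1) max_dist v].

Definition remoteness_graph : rel (T * T) :=
  fun p q => (p != q) &&
    [|| p.1 == q.1, p.2 == q.2
      | [exists g in G, (p.2 == g p.1) && (q.2 == g q.1)]].

End Remoteness.

(* Main.v *)
Require Import Defs.
From mathcomp Require Import all_boot all_fingroup.

Set Implicit Arguments.
Unset Strict Implicit.
Unset Printing Implicit Defensive.

(** Both sides of the equivalence say that some permutation [v] agrees with
    every element of [G] in exactly one point.

    - A stable set of the remoteness graph has pairwise distinct first
      coordinates and pairwise distinct second coordinates, so it has at most
      [n] elements, and one with [n] elements is the graph of a permutation
      [v].  The remaining adjacencies express that some [g] in [G] agrees with
      [v] in two points; stability of the graph of [v] thus means that every
      [g] in [G] agrees with [v] in at most one point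
      ([stable_perm_graph], [card_stable_remoteness_graph]).

    - Distance at most [n - 1] means agreement in at least one point, so
      [max_dist G v <= n - 1] says that every [g] in [G] agrees with [v] in at
      least one point ([max_dist_leP]).

    For transitive [G], for each [x] exactly [#|G| / n] elements of [G] map
    [x] to [v x], so the number of agreements with [v] has average 1 over [G]
    ([sum_agreement]).  Hence at most one everywhere, at least one everywhere
    and exactly one everywhere are equivalent conditions on [v]; moreover no
    [v] has [max_dist G v < n - 1], so that the remoteness is [n - 1] as soon
    as one such [v] exists. *)

Section Agreement.

Variable T : finType.
Implicit Types (v g : {perm T}) (G : {group {perm T}}) (S : {set T * T}).

Definition agreement v g : nat := #|[set x | v x == g x]|.

Definition perm_graph v : {set T * T} := [set (x, v x) | x in [set: T]].

Lemma agreement_hamming_dist v g : agreement v g + hamming_dist v g = #|T|.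
Proof.
rewrite -(cardsC [set x | v x == g x]); congr (_ + _).
by apply: eq_card => x; rewrite !inE.
Qed.

Lemma card_perm_graph v : #|perm_graph v| = #|T|.
Proof. by rewrite card_imset ?cardsT // => x y []. Qed.

(** A transitive action has an orbit, so it is on a nonempty set. *)
Lemma transitive_card_gt0 G : [transitive G, on [set: T] | 'P] -> 0 < #|T|.
Proof. by case/imsetP=> x _ _; apply/card_gt0P; exists x. Qed.

Lemma card_move_transitive G x y : [transitive G, on [set: T] | 'P] ->
  (#|T| * #|[set g in G | y == g x]|)%N = #|G|.
Proof.
move=> trG; have [h hG ->] : exists2 h, h \in G & y = 'P%act x h.
  by apply: (atransP2 trG); rewrite inE.
(* The elements taking [x] to [y] form a coset of the stabiliser of [x]. *)
have -> : [set g in G | 'P%act x h == g x] = ('C_G[x | 'P] :* h)%g.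
  rewrite -amove_act ?subsetT //.
  by apply/setP => g; rewrite !inE eq_sym.
by rewrite card_rcoset -(card_orbit_stab 'P G x) (atransP trG) ?inE // cardsT.
Qed.

(** Double counting of the pairs of a point [x] and an element of [G] that
    agrees with [v] at [x]. *)
Lemma sum_agreement G v : [transitive G, on [set: T] | 'P] ->
  \sum_(g in G) agreement v g = #|G|.
Proof.
move=> trG; have T_gt0 := transitive_card_gt0 trG.
apply/eqP; rewrite -(eqn_pmul2l T_gt0); apply/eqP.
transitivity (#|T| * \sum_x #|[set g in G | v x == g x]|)%N.
  congr (_ * _)%N.
  under eq_bigr => g _ do rewrite /agreement -sum1dep_card big_mkcond /=.
  rewrite exchange_big /=; apply: eq_bigr => x _.
  by rewrite -sum1dep_card big_mkcondr.
rewrite big_distrr /= (eq_bigr (fun=> #|G|)) ?sum_nat_const // => x _.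
exact: card_move_transitive.
Qed.

(** A function with average 1 that is everywhere at most 1 is constant. *)
Lemma agreement_le1_eq1 G v : [transitive G, on [set: T] | 'P] ->
  {in G, forall g, agreement v g <= 1} -> {in G, forall g, agreement v g = 1}.
Proof.
move=> trG le1 g gG.
have [_] := leqif_sum (fun h hG => leqif_eq (le1 h hG)).
rewrite sum_agreement // sum1_card eqxx => /esym/forall_inP/(_ g gG).
by move/eqP.
Qed.

(** A function with average 1 that is everywhere at least 1 is constant. *)
Lemma agreement_ge1_eq1 G v : [transitive G, on [set: T] | 'P] ->
  {in G, forall g, 0 < agreement v g} -> {in G, forall g, agreement v g = 1}.
Proof.
move=> trG ge1 g gG.
have [_] := leqif_sum (fun h hG => leqif_eq (ge1 h hG)).
rewrite sum_agreement // sum1_card eqxx => /esym/forall_inP/(_ g gG).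
by move/eqP.
Qed.

Lemma max_dist_leP G v : 0 < #|T| ->
  reflect {in G, forall g, 0 < agreement v g} (max_dist G v <= #|T| - 1).
Proof.
move=> T_gt0; apply: (iffP (bigmax_leqP _ _ _)) => le g /le {le}.
  rewrite -(agreement_hamming_dist v g) in T_gt0 *.
  by case: agreement T_gt0 => // d_gt0; rewrite add0n leqNgt ltn_subrL d_gt0.
by rewrite -(agreement_hamming_dist v g) addnC => /addnBA <-; rewrite leq_addr.
Qed.

(** If no distance exceeds [#|T| - 1], then every agreement is positive, hence
    equal to 1, and the identity of [G] is at distance [#|T| - 1] from [v]. *)
Lemma max_dist_ge G v : [transitive G, on [set: T] | 'P] ->
  #|T| - 1 <= max_dist G v.
Proof.
move=> trG; have T_gt0 := transitive_card_gt0 trG.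
have [|/ltnW //] := leqP (max_dist G v) (#|T| - 1).
move/(max_dist_leP G v T_gt0) => ge1.
rewrite -(agreement_hamming_dist v 1%g) (agreement_ge1_eq1 trG ge1) // addKn.
exact: leq_bigmax_cond.
Qed.

Lemma remoteness_eq_iff G : [transitive G, on [set: T] | 'P] ->
  remoteness G = #|T| - 1 <->
  exists v, {in G, forall g, agreement v g = 1}.
Proof.
move=> trG; have T_gt0 := transitive_card_gt0 trG.
rewrite /remoteness; case: arg_minnP => // w _ w_min.
split=> [w_dist | [v v1]].
  exists w; apply: agreement_ge1_eq1 => //.
  by apply/max_dist_leP; rewrite ?w_dist.
apply/eqP; rewrite eqn_leq max_dist_ge // andbT.
apply: leq_trans (w_min v isT) _.
by apply/max_dist_leP => // g /v1 ->.
Qed.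

Lemma stable_fst_inj G S : stable_set (remoteness_graph G) S ->
  {in S &, injective fst}.
Proof.
move=> stS p q pS qS eq1; apply: contraTeq stS => npq.
apply/forall_inPn; exists p => //; apply/forall_inPn; exists q => //.
by rewrite npq /remoteness_graph npq eq1 eqxx.
Qed.

Lemma stable_snd_inj G S : stable_set (remoteness_graph G) S ->
  {in S &, injective snd}.
Proof.
move=> stS p q pS qS eq2; apply: contraTeq stS => npq.
apply/forall_inPn; exists p => //; apply/forall_inPn; exists q => //.
by rewrite npq /remoteness_graph npq eq2 eqxx orbT.
Qed.

Lemma card_stable_le G S : stable_set (remoteness_graph G) S -> #|S| <= #|T|.
Proof. by move/stable_fst_inj/card_in_imset <-; apply: max_card. Qed.

(** Distinct points of the graph of a permutation never share a coordinate, so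
    only the adjacencies coming from elements of [G] can occur. *)
Lemma stable_perm_graph G v :
  reflect {in G, forall g, agreement v g <= 1}
          (stable_set (remoteness_graph G) (perm_graph v)).
Proof.
apply: (iffP forall_inP) => [st g gG | le1 _ /imsetP[x _ ->]].
  apply/card_le1_eqP => y x; rewrite !inE => vgy vgx.
  apply: contraTeq isT => nxy.
  have /forall_inP/(_ (y, v y) (imset_f _ (in_setT y))) :=
    st _ (imset_f (fun z => (z, v z)) (in_setT x)).
  have nxyv : (x, v x) != (y, v y) by rewrite xpair_eqE negb_and nxy.
  rewrite /remoteness_graph nxyv /= => /norP[_ /norP[_ /exists_inP[]]].
  by exists g; rewrite ?vgx.
apply/forall_inP => _ /imsetP[y _ ->]; apply/implyP => nxyv.
have nxy : x != y by apply: contraNneq nxyv => ->.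
rewrite /remoteness_graph nxyv /= (inj_eq perm_inj) (negPf nxy) /=.
apply/exists_inP => -[g /le1/card_le1_eqP le1g /andP[vgx vgy]].
by case/eqP: nxy; apply: le1g; rewrite inE.
Qed.

(** By counting, a stable set of size [#|T|] has every point as a first
    coordinate, hence is the graph of a function; this function is injective
    because second coordinates are distinct. *)
Lemma card_stable_remoteness_graph G S :
  stable_set (remoteness_graph G) S -> #|S| = #|T| ->
  exists v, S = perm_graph v.
Proof.
move=> stS cardS.
have /setP imT : [set p.1 | p in S] = setT.
  apply/eqP; rewrite eqEcard subsetT cardsT card_in_imset ?cardS //=.
  exact: stable_fst_inj stS.
have val x : exists y, (x, y) \in S.
  by have /imsetP[[x' y] xyS /= ->] : x \in [set p.1 | p in S];
    [rewrite imT inE | exists y].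
pose f x := xchoose (val x); have fS x : (x, f x) \in S := xchooseP (val x).
have f_inj : injective f.
  by move=> x y eqf; have [] := stable_snd_inj stS (fS x) (fS y) eqf.
exists (perm f_inj); apply/esym/eqP.
rewrite eqEcard card_perm_graph cardS leqnn andbT.
by apply/subsetP => _ /imsetP[x _ ->]; rewrite permE.
Qed.

Lemma stability_number_le G : stability_number (remoteness_graph G) <= #|T|.
Proof. by apply/bigmax_leqP => S; apply: card_stable_le. Qed.

Lemma stability_number_eq_iff G : [transitive G, on [set: T] | 'P] ->
  stability_number (remoteness_graph G) = #|T| <->
  exists v, {in G, forall g, agreement v g = 1}.
Proof.
move=> trG; split=> [max_eq | [v v1]].
  have st0 : stable_set (remoteness_graph G) set0.
    by apply/forall_inP => p; rewrite inE.
  have [S stS maxS] :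
      {S | stable_set (remoteness_graph G) S &
           stability_number (remoteness_graph G) = #|S|}.
    by apply: eq_bigmax_cond; apply/card_gt0P; exists set0.
  rewrite maxS in max_eq.
  have [v defS] := card_stable_remoteness_graph stS max_eq.
  exists v; apply: agreement_le1_eq1 => //.
  by apply/stable_perm_graph; rewrite -defS.
apply/eqP; rewrite eqn_leq stability_number_le -(card_perm_graph v).
apply: (@leq_bigmax_cond _ _ (fun S : {set T * T} => #|S|)).
by apply/stable_perm_graph => g /v1 ->.
Qed.

End Agreement.

Theorem proposition15 (T : finType) (G : {group {perm T}}) (n : nat)
    (cardT : #|T| = n)
    (trG : [transitive G, on [set: T] | 'P]) :
  stability_number (remoteness_graph G) <= n /\
  (stability_number (remoteness_graph G) = n <-> remoteness G = n - 1).
Proof.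
rewrite -{n}cardT; split; first exact: stability_number_le.
apply: (iff_trans (stability_number_eq_iff trG)); apply: iff_sym.
exact: remoteness_eq_iff.
Qed.
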